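(* For a label $\mathcal M$ the following are equivalent: (i) $\mathcal M$ is recurrent for the $FIN(\mathbb N)$ action on $\mathcal{LAB}$; (ii) $x[\mathcal M]$ is a recurrent point for the shift homeomorphism $S$ on $\{0,1\}^{\mathbb Z}$; (iii) $x_+[\mathcal M]$ is a recurrent point for the shift homeomorphism $S$ on $\{0,1\}^{\mathbb Z}$.
   Context: Write $\mathbb N=\{1,2,\dots\}$. An $\mathbb N$-vector is a function $\mathbf m:\mathbb N\to\{0,1,2,\dots\}$ with finite support $\mathrm{supp}\,\mathbf m$; $FIN(\mathbb N)$ is the additive monoid of all $\mathbb N$-vectors, with identity $\mathbf 0$ and the pointwise order. A label is a set $\mathcal M\subset FIN(\mathbb N)$ such that $\mathbf 0\le\mathbf m_1\le\mathbf m\in\mathcal M$ implies $\mathbf m_1\in\mathcal M$. $\mathcal{LAB}$ is the space of all labels (including $\emptyset$) with the ultrametric $d(\mathcal M_1,\mathcal M_2)=\inf\{2^{-N}:N\ge0,\ \mathcal M_1\cap\mathcal B_N=\mathcal M_2\cap\mathcal B_N\}$, where $\mathcal B_N$ is the set of $\mathbb N$-vectors $\mathbf m$ with $\mathbf m_\ell<N$ for all $\ell$ and $\mathrm{supp}\,\mathbf m\subset[1,N]$. $FIN(\mathbb N)$ acts by $P_{\mathbf r}(\mathcal M)=\mathcal M-\mathbf r=\{\mathbf w\in FIN(\mathbb N):\mathbf w+\mathbf r\in\mathcal M\}$. A label $\mathcal M$ is recurrent if it lies in the closure of $\{\mathcal M-\mathbf r:\mathbf r\in FIN(\mathbb N),\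 \mathbf r\ne\mathbf 0\}$. Fix an odd integer $b\ge5$ and a partition $\{D_\ell:\ell\in\mathbb N\}$ of $\mathbb N$ into infinite sets with $\min D_\ell<\min D_{\ell+1}$. Define $k:\mathbb Z\to\mathbb Z$ by $k(n)=b^{n-1}$ for $n\ge1$, $k(0)=0$, $k(-n)=-k(n)$. $IP(k)$ (resp. $IP_+(k)$) is the set of sums of finite subsets of $k(\mathbb Z)$ (resp. of $k(\{0,1,2,\dots\})$). Each $t\in IP(k)$ has a unique expansion $t=k(j_1)+\dots+k(j_r)$ with $|j_1|>\dots>|j_r|>0$ ($r=0$ for $t=0$); its length vector $\mathbf r(t)\in FIN(\mathbb N)$ is $\mathbf r(t)_\ell=\#\{i:|j_i|\in D_\ell\}$. For a label $\mathcal M$, $A[\mathcal M]=\{t\in IP(k):\mathbf r(t)\in\mathcal M\}$, $A_+[\mathcal M]=A[\mathcal M]\cap IP_+(k)$, and $x[\mathcal M],x_+[\mathcal M]\in\{0,1\}^{\mathbb Z}$ are the characteristic functions of $A[\mathcal M]$ and $A_+[\mathcal M]$. $S$ is the shift $S(x)_t=x_{t+1}$. A point $x$ is recurrent for $S$ if it lies in the closure of $\{S^nx:n\in\mathbb Z,\ n\ne0\}$. *)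

(* Defs.v *)
From HB Require Import structures.
From mathcomp Require Import all_boot all_order all_algebra finmap.
From mathcomp Require Import all_classical all_reals all_analysis.

Set Implicit Arguments.
Unset Strict Implicit.
Unset Printing Implicit Defensive.

Import Order.TTheory GRing.Theory Num.Theory.

Local Open Scope classical_set_scope.
Local Open Scope ring_scope.

(* The index set {1, 2, ...}. *)
Definition posnat := {n : nat | (0 < n)%N}.

Definition Nvector := {fsfun posnat -> nat with 0%N}.

HB.instance Definition _ := Choice.copy Nvector {fsfun posnat -> nat with 0%N}.

Definition nvec0 : Nvector := [fsfun with 0%N].

Definition nvec_add (m r : Nvector) : Nvector :=
  [fsfun l in (finsupp m `|` finsupp r)%fset => (m l + r l)%N | 0%N].

Lemma nvec_addE (m r : Nvector) (l : posnat) : nvec_add m r l = (m l + r l)%N.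
Proof.
rewrite fsfunE in_fsetU; case: ifPn => //; rewrite negb_or => /andP[].
by move=> /fsfun_dflt -> /fsfun_dflt ->.
Qed.

Lemma nvec_addA : associative nvec_add.
Proof. by move=> m r s; apply/fsfunP => l; rewrite !nvec_addE addnA. Qed.

Lemma nvec_addC : commutative nvec_add.
Proof. by move=> m r; apply/fsfunP => l; rewrite !nvec_addE addnC. Qed.

Lemma nvec_add0 : left_id nvec0 nvec_add.
Proof. by move=> m; apply/fsfunP => l; rewrite nvec_addE fsfunE. Qed.

HB.instance Definition _ :=
  GRing.isNmodule.Build Nvector nvec_addA nvec_addC nvec_add0.

Definition nvec_le (m r : Nvector) : Prop := forall l, (m l <= r l)%N.

Record label := Label {
  label_set :> set Nvector;
  label_down : forall m1 m : Nvector, nvec_le m1 m -> label_set m -> label_set m1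
}.

HB.instance Definition _ := gen_eqMixin label.
HB.instance Definition _ := gen_choiceMixin label.

Lemma label_ext (M1 M2 : label) : label_set M1 = label_set M2 -> M1 = M2.
Proof.
case: M1 M2 => [S1 d1] [S2 d2] /= eS; case: S2 / eS d2 => d2.
by congr Label; apply: Prop_irrelevance.
Qed.

Definition nvec_box (N : nat) : set Nvector :=
  [set m : Nvector | (forall l, (m l < N)%N) /\
           (forall l, l \in finsupp m -> (1 <= val l <= N)%N)].

Definition agree (N : nat) (M1 M2 : label) : Prop :=
  M1 `&` nvec_box N = M2 `&` nvec_box N.

Definition label_dist (R : realType) (M1 M2 : label) : R :=
  inf [set 2 ^- N | N in [set N : nat | agree N M1 M2]].

(* The real field R is a phantom parameter: it only serves as the codomain of
   the ultrametric carried by LAB R. *)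
Definition LAB (R : realType) : Type := label.

HB.instance Definition _ (R : realType) := Choice.copy (LAB R) label.

Section label_dist_theory.
Variable R : realType.
Implicit Types M : label.
Let dist := @label_dist R.
Let dset M1 M2 : set R := [set 2 ^- N | N in [set N : nat | agree N M1 M2]].

Lemma nvec_box_le (N1 N2 : nat) : (N1 <= N2)%N -> nvec_box N1 `<=` nvec_box N2.
Proof.
move=> le12 m [mN sN]; split=> [l|l /sN/andP[-> /= lN]].
  exact: leq_trans (mN l) le12.
exact: leq_trans lN le12.
Qed.

Lemma nvec_box_cover (m : Nvector) : exists N, nvec_box N m.
Proof.
exists (\max_(l <- finsupp m) maxn (val l) (m l)).+1; split=> l.
  case: finsuppP => [//|lm]; rewrite ltnS.
  exact: leq_trans (leq_maxr _ _) (leq_bigmax_seq _ lm isT).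
move=> lm; rewrite (valP l) /=; apply: leqW.
exact: leq_trans (leq_maxl _ _) (leq_bigmax_seq _ lm isT).
Qed.

Lemma agree_le (N1 N2 : nat) M1 M2 :
  (N1 <= N2)%N -> agree N2 M1 M2 -> agree N1 M1 M2.
Proof.
move=> le12 ag; have e := (setIidPr _ _).2 (nvec_box_le le12).
by rewrite /agree -e (setIA (label_set M1)) (setIA (label_set M2)) ag.
Qed.

Lemma agree0 M1 M2 : agree 0 M1 M2.
Proof.
have b0 : nvec_box 0 = set0.
  by rewrite -subset0 => m [/(_ (exist _ 1%N isT))]; rewrite ltn0.
by rewrite /agree b0 !setI0.
Qed.

Lemma dset_neq0 M1 M2 : dset M1 M2 !=set0.
Proof. by exists (2 ^- 0); exists 0%N => //; exact: agree0. Qed.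

Lemma dset_lb M1 M2 : lbound (dset M1 M2) 0.
Proof. by move=> _ [N _ <-]; rewrite invr_ge0 exprn_ge0. Qed.

Lemma label_dist_ge0 M1 M2 : 0 <= dist M1 M2.
Proof. by apply: lb_le_inf; [exact: dset_neq0|exact: dset_lb]. Qed.

Lemma label_dist_agree N M1 M2 : agree N M1 M2 -> dist M1 M2 <= 2 ^- N.
Proof. by move=> ag; apply: ge_inf; [exists 0; exact: dset_lb|exists N]. Qed.

Lemma label_dist_lt N M1 M2 : dist M1 M2 < 2 ^- N -> agree N M1 M2.
Proof.
move=> /(inf_lt (dset_neq0 M1 M2)) [_ [N' ag <-]].
rewrite ltf_pV2 ?posrE ?exprn_gt0// ltr_eXn2l ?ltr1n// => /ltnW.
by move=> /agree_le; apply.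
Qed.

Lemma label_distxx M : dist M M = 0.
Proof.
apply/eqP; rewrite eq_le label_dist_ge0 andbT leNgt; apply/negP => d0.
have [N Nd] : exists N : nat, 2 ^- N < dist M M.
  have [N _ /(_ _ (leqnn N)) /=] := near_infty_natSinv_expn_lt (PosNum d0).
  by move=> h; exists N; move: h; rewrite div1r.
have := label_dist_agree (erefl (M `&` nvec_box N)).
by rewrite leNgt Nd.
Qed.

Lemma label_dist_positivity M1 M2 : dist M1 M2 = 0 -> M1 = M2.
Proof.
move=> d0; apply: label_ext; apply/seteqP.
have ag N : agree N M1 M2.
  by apply: label_dist_lt; rewrite d0 invr_gt0 exprn_gt0.
split=> m mM; have [N mN] := nvec_box_cover m.
  by have [] : (M2 `&` nvec_box N) m by rewrite -(ag N).
by have [] : (M1 `&` nvec_box N) m by rewrite (ag N).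
Qed.

Lemma label_dist_sym M1 M2 : dist M1 M2 = dist M2 M1.
Proof.
rewrite /dist /label_dist; congr inf; apply/seteqP.
by split=> _ [N ag <-]; exists N => //; exact: esym.
Qed.

Lemma label_dist_triangle M2 M1 M3 : dist M1 M3 <= dist M1 M2 + dist M2 M3.
Proof.
rewrite -lerBlDr; apply: lb_le_inf; first exact: dset_neq0.
move=> _ [N1 ag1 <-]; rewrite lerBlDr -lerBlDl.
apply: lb_le_inf; first exact: dset_neq0.
move=> _ [N2 ag2 <-]; rewrite lerBlDl.
have ag : agree (minn N1 N2) M1 M3.
  by apply: etrans (agree_le (geq_minl N1 N2) ag1) _;
    exact: agree_le (geq_minr N1 N2) ag2.
apply: le_trans (label_dist_agree ag) _.
have p N : 0 <= 2 ^- N :> R by rewrite invr_ge0 exprn_ge0.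
by case: leqP => _; [rewrite lerDl|rewrite lerDr].
Qed.

End label_dist_theory.

HB.instance Definition _ (R : realType) :=
  @isMetric.Build R (LAB R) (@label_dist R) (@label_distxx R)
    (@label_dist_positivity R) (@label_dist_sym R) (@label_dist_triangle R).

Lemma label_sub_down (M : label) (r m1 m : Nvector) :
  nvec_le m1 m -> label_set M (m + r) -> label_set M (m1 + r).
Proof.
move=> le1 /label_down; apply=> l.
by rewrite /GRing.add /= !nvec_addE leq_add2r.
Qed.

Definition label_sub (M : label) (r : Nvector) : label :=
  Label (label_set := [set w | label_set M (w + r)]) (@label_sub_down M r).

Definition label_recurrent (R : realType) (M : LAB R) : Prop :=
  closure [set (label_sub M r : LAB R) | r in [set r : Nvector | r != 0]] M.

Definition is_min (A : set nat) (n : nat) : Prop := A n /\ lbound A n.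

Definition ip_partition (D : posnat -> set nat) : Prop :=
  [/\ classical_sets.partition setT D [set n | (0 < n)%N],
      forall l, infinite_set (D l)
    & forall (l l' : posnat) (n n' : nat), val l' = (val l).+1 ->
        is_min (D l) n -> is_min (D l') n' -> (n < n')%N].

(* Negz n stands for - n.+1. *)
Definition kseq (b : nat) (n : int) : int :=
  match n with
  | Posz 0 => 0
  | Posz n'.+1 => b%:Z ^+ n'
  | Negz n' => - b%:Z ^+ n'
  end.

Definition finite_sums (E : set int) : set int :=
  [set t | exists F : {fset int}, [set` F] `<=` E /\ t = \sum_(x <- F) x].

Definition IP (b : nat) : set int := finite_sums (kseq b @` setT).

Definition IPplus (b : nat) : set int := finite_sums (kseq b @` [set n | 0 <= n]).

Definition is_expansion (b : nat) (t : int) (s : seq int) : Prop :=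
  [/\ t = \sum_(j <- s) kseq b j,
      sorted gtn [seq `|j|%N | j <- s]
    & all (fun j => 0 < `|j|)%N s].

(* For b >= 3 every t in IP b has exactly one expansion, so that the choice
   operator returns it; outside IP b the value is irrelevant. *)
Definition expansion (b : nat) (t : int) : seq int :=
  xget [::] [set s | is_expansion b t s].

Definition hits (D : posnat -> set nat) (s : seq int) (l : posnat) : nat :=
  count (fun j => `|j|%N \in D l) s.

(* fset_set is a junk value on infinite sets, but the support below is finite
   as soon as the sets D l are pairwise disjoint: see length_vectorE. *)
Definition length_vector (b : nat) (D : posnat -> set nat) (t : int) : Nvector :=
  [fsfun l in fset_set [set l | (0 < hits D (expansion b t) l)%N] =>
     hits D (expansion b t) l | 0%N].

Lemma finite_hits (D : posnat -> set nat) (s : seq int) :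
  trivIset setT D -> finite_set [set l | (0 < hits D s l)%N].
Proof.
move=> tD; elim: s => [|j s IHs].
  by rewrite (_ : [set _ | _] = set0)// -subset0 => l.
apply: (@sub_finite_set _ _ ([set l | D l `|j|%N] `|` [set l | (0 < hits D s l)%N])).
  move=> l; rewrite /hits /=; case: (boolP (_ \in D l)) => [|_].
    by rewrite inE; left.
  by rewrite add0n; right.
rewrite finite_setU; split=> //.
have [->|/set0P[l0 jl0]] := eqVneq [set l | D l `|j|%N] set0; first exact: finite_set0.
apply: (@sub_finite_set _ _ [set l0]); last exact: finite_set1.
by move=> l jl; apply: tD => //; exists `|j|%N.
Qed.

Lemma length_vectorE (b : nat) (D : posnat -> set nat) (t : int) (l : posnat) :
  trivIset setT D -> length_vector b D t l = hits D (expansion b t) l.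
Proof.
move=> tD; rewrite fsfunE in_fset_set; last exact: finite_hits.
by case: ifPn => //; rewrite notin_setE /= => /negP; rewrite -eqn0Ngt => /eqP.
Qed.

Definition Aset (b : nat) (D : posnat -> set nat) (M : label) : set int :=
  [set t | IP b t /\ label_set M (length_vector b D t)].

Definition Aset_plus (b : nat) (D : posnat -> set nat) (M : label) : set int :=
  Aset b D M `&` IPplus b.

Definition bishift : Type := prod_topology (fun _ : int => bool).

HB.instance Definition _ := Topological.copy bishift
  (prod_topology (fun _ : int => bool)).

Definition char_fun (A : set int) : bishift := fun t => t \in A.

Definition shift (x : bishift) : bishift := fun t => x (t + 1).

Definition shift_inv (x : bishift) : bishift := fun t => x (t - 1).

Lemma shiftK : cancel shift shift_inv.
Proof. by move=> x; apply/funext => t; rewrite /shift_inv /shift subrK. Qed.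

Lemma shift_invK : cancel shift_inv shift.
Proof. by move=> x; apply/funext => t; rewrite /shift_inv /shift addrK. Qed.

Definition shiftz (n : int) (x : bishift) : bishift :=
  match n with
  | Posz n' => iter n' shift x
  | Negz n' => iter n'.+1 shift_inv x
  end.

Definition shift_recurrent (x : bishift) : Prop :=
  closure [set shiftz n x | n in [set n : int | n != 0]] x.

(* Main.v *)
Require Import Defs.
From mathcomp Require Import all_boot all_order all_algebra finmap.
From mathcomp Require Import all_classical all_reals all_analysis.
From mathcomp Require Import zify.

Set Implicit Arguments.
Unset Strict Implicit.
Unset Printing Implicit Defensive.

Import Order.TTheory GRing.Theory Num.Theory.

Local Open Scope classical_set_scope.
Local Open Scope ring_scope.

(** Both recurrence notions say that finite windows come back.  A label [M] is
    recurrent when, for every box [N], some nonzero [r] makes [M - r] and [M]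
    agree on the box ([label_recurrentP]); a point [x] is recurrent when every
    window [-T, T] has a nonzero return time [n] ([shift_recurrentP]).  The
    bridge is arithmetic in base [b] with digits -1, 0, 1.

    Expansions in base [b] are unique, so digits may be compared one by one
    ([digits_eq0]).  If [u] has only digits of index above [m] and [t] only
    digits of index at most [m], then [t + u] is expanded by juxtaposition and
    r(t + u) = r(t) + r(u); hence the set of [M] translated by [u] looks, near
    0, like the set of [M - r(u)] ([Aset_over_high]).

    From labels to points: given a window, choose a return vector [r] of [M] for
    a box containing the length vectors of the window, and realize [r] by a sum
    [u] of large index.  Then [u] is a return time; integers of the window that
    have no expansion cause no trouble because a small [t] with [t + u]
    expandable is the low part of [t + u] ([low_part]).

    From points to labels: suppose that [M] is nonempty, so that 0 belongs to
    its set.  Take [K] such that sums with positive indices at most [K] realize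
    every vector of the given box, and let [n] be a return time for a window
    containing all the sums with indices at most [K].  Then [n] belongs to the set as well.  Its low
    part [lo] (indices at most [K]) has a smaller length vector, so it lies in
    the set and in the window, and therefore [n + lo] lies in the set.  But
    [n + lo] has a digit 2 or -2 wherever [lo] has a nonzero digit, which for
    [b >= 5] excludes an expansion with digits -1, 0, 1 ([no_doubling]).  So
    [lo] is empty, [n] has only large indices, and [r(n)] is the required
    return vector.

    The argument applies to the sums over any index set [J] containing the
    positive integers; the theorem compares the cases where [J] is everything
    and where [J] is the set of nonnegative integers. *)

(** * Recurrence through finite windows *)

Lemma shiftzE (n : int) (x : bishift) (t : int) : shiftz n x t = x (t + n).
Proof.
case: n => n /=.
  by elim: n t => [|n IHn] t; rewrite ?addr0 //= {1}/Defs.shift IHn; congr x; lia.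
elim: n t => [|n IHn] t /=; first by rewrite /shift_inv; congr x; lia.
by rewrite /= in IHn *; rewrite {1}/shift_inv IHn; congr x; lia.
Qed.

Lemma shift_recurrentP (x : bishift) :
  shift_recurrent x <->
  forall T : nat, exists2 n : int, n != 0 &
    forall t : int, (`|t| <= T)%N -> x (t + n) = x t.
Proof.
split=> [recx T|recx].
  (* A window is a finite intersection of coordinate conditions. *)
  have coord t : nbhs x [set y : bishift | y t = x t].
    have := @proj_continuous int (fun=> bool) t x [set x t].
    by apply; rewrite nbhs_principalE.
  have window : nbhs x [set y : bishift | forall t, (`|t| <= T)%N -> y t = x t].
    elim: T => [|T IHT].
      by apply: filterS (coord 0) => y y0 t; rewrite leqn0 absz_eq0 => /eqP ->.
    apply: filterS (filterI IHT (filterI (coord T.+1%:Z) (coord (- T.+1%:Z)))).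
    move=> y [yT [yp yn]] t; rewrite leq_eqVlt => /predU1P[tT|]; last exact: yT.
    by have [->|->] : t = T.+1%:Z \/ t = - T.+1%:Z by lia.
  have [_ [[n n0 <-] nx]] := recx _ window.
  by exists n => // t tT; rewrite -(nx t tT) shiftzE.
have /choice[n nP] : forall T : nat, exists n : int, n != 0 /\
    forall t : int, (`|t| <= T)%N -> x (t + n) = x t.
  by move=> T; have [n n0 nx] := recx T; exists n.
(* The translates by return times of growing windows converge to [x]
   coordinatewise, hence in the product topology. *)
have nx : (fun T => shiftz (n T) x) @ \oo --> x.
  apply/cvg_sup => t W /= [_ [[V _ <-] /= Vxt] VW].
  exists `|t|%N => // T /= tT; apply: VW.
  by rewrite /= shiftzE (nP T).2.
move=> B /nx[T _ TB]; exists (shiftz (n T) x); split; last exact: (TB T (leqnn T)).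
by exists (n T) => //; exact: (nP T).1.
Qed.

Lemma label_recurrentP (R : realType) (M : LAB R) :
  label_recurrent M <->
  forall N : nat, exists2 r : Nvector, r != 0 & agree N (label_sub M r) M.
Proof.
split=> [recM N|recM].
  have [] := recM (ball (M : LAB R) (2 ^- N)).
    by apply: nbhsx_ballx; rewrite invr_gt0 exprn_gt0.
  move=> _ [[r r0 <-]]; rewrite ballEmdist /= => /label_dist_lt agM.
  by exists r => //; exact: esym.
move=> B /nbhs_ballP[e /= e0 eB].
have [N _ /(_ N (leqnn N)) /=] := near_infty_natSinv_expn_lt (PosNum e0).
rewrite div1r => Ne; have [r r0 ag] := recM N.
exists (label_sub M r); split; first by exists r.
apply: eB; rewrite ballEmdist /=; apply: le_lt_trans Ne.
by apply: label_dist_agree; exact: esym.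
Qed.

(** * Expansions with digits -1, 0, 1 *)

(** Reducing modulo [b] kills [e 0], since [|e 0| < b]; then divide by [b].
    Applied to differences of digit sequences, it gives the uniqueness of
    expansions and the failure of doubling. *)
Lemma digits_eq0 (b N : nat) (e : nat -> int) :
  (forall i, (i < N)%N -> (`|e i| < b)%N) ->
  \sum_(i < N) e i * b%:Z ^+ i = 0 -> forall i, (i < N)%N -> e i = 0.
Proof.
elim: N e => [//|N IHN] e eb; rewrite big_ord_recl expr0 mulr1 /=.
set tl := (X in _ + X) => sum0.
have tlE : tl = (\sum_(i < N) e i.+1 * b%:Z ^+ i) * b%:Z.
  by rewrite mulr_suml; apply: eq_bigr => i _; rewrite -mulrA -exprSr.
have e0 : e 0 = 0.
  have : (b %| `|e 0|)%N.
    have -> : e 0 = - (\sum_(i < N) e i.+1 * b%:Z ^+ i) * b%:Z.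
      by rewrite mulNr -tlE; apply/eqP; rewrite -addr_eq0 sum0.
    by rewrite abszM dvdn_mull.
  have := eb 0 isT; case: (posnP `|e 0|) => [|e0 lt /(dvdn_leq e0)]; lia.
have b0 : b%:Z != 0 by have := eb 0 isT; lia.
have tl0 : \sum_(i < N) e i.+1 * b%:Z ^+ i = 0.
  have /eqP := sum0; rewrite e0 add0r tlE mulf_eq0 (negPf b0) orbF.
  by move/eqP.
case=> [//|i iN]; apply: (IHN (fun i => e i.+1) _ tl0) => // j jN.
exact: eb.
Qed.

Definition ksum (b : nat) (s : seq int) : int := \sum_(j <- s) kseq b j.

(** The condition on indices in [is_expansion], in a form that passes to
    concatenations and subsequences. *)
Definition reduced (s : seq int) : bool :=
  pairwise (fun j k : int => `|k| < `|j|)%N s && all (fun j : int => 0 < `|j|)%N s.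

Lemma is_expansionE (b : nat) (t : int) (s : seq int) :
  is_expansion b t s <-> t = ksum b s /\ reduced s.
Proof.
rewrite /is_expansion /reduced sorted_map sorted_pairwise; last first.
  by move=> k j l /= kj lk; exact: ltn_trans lk kj.
by split=> [[-> -> ->]|[-> /andP[-> ->]]].
Qed.

Lemma reduced_filter (p : pred int) (s : seq int) :
  reduced s -> reduced [seq j <- s | p j].
Proof.
case/andP=> ps as0; rewrite /reduced pairwise_filter //=.
by apply/allP => j; rewrite mem_filter => /andP[_ /(allP as0)].
Qed.

Lemma reduced_cat (m : nat) (s s' : seq int) :
  reduced s -> reduced s' ->
  {in s, forall j : int, m < `|j|}%N -> {in s', forall j : int, `|j| <= m}%N ->
  reduced (s ++ s').
Proof.
move=> /andP[ps s0] /andP[ps' s'0] sm s'm.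
rewrite /reduced pairwise_cat ps ps' all_cat s0 s'0 !andbT.
apply/allrelP => j k js ks'; exact: leq_ltn_trans (s'm k ks') (sm j js).
Qed.

Lemma reduced_absz_inj (s : seq int) :
  reduced s -> {in s &, forall j k : int, `|j|%N = `|k|%N -> j = k}.
Proof.
case/andP=> + _; elim: s => [//|i s IHs] /= /andP[/allP is_ /IHs injs] j k.
rewrite !inE => /predU1P[->|js] /predU1P[->|ks] //.
- by move=> e; have := is_ k ks; rewrite e ltnn.
- by move=> e; have := is_ j js; rewrite e ltnn.
exact: injs.
Qed.

Lemma reduced_uniq (s : seq int) : reduced s -> uniq s.
Proof.
case/andP=> ps _; apply: (@pairwise_uniq _ (fun j k : int => `|k| < `|j|)%N) => //.
by move=> j; rewrite ltnn.
Qed.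

Lemma reduced_neq0 (s : seq int) (j : int) : reduced s -> j \in s -> j != 0.
Proof. by case/andP=> _ /allP s0 /s0; rewrite absz_gt0. Qed.

Lemma reduced_opp (s : seq int) (j : int) : reduced s -> j \in s -> - j \notin s.
Proof.
move=> rs js; apply/negP => js'.
have := reduced_absz_inj rs js js'; have := reduced_neq0 rs js; lia.
Qed.

(** Defined by membership, so that its values are -1, 0 or 1 for every list;
    the indices 1, 2, ... carry the digits 0, 1, ... *)
Definition digit (s : seq int) (i : nat) : int :=
  (i.+1%:Z \in s)%:Z - (- i.+1%:Z \in s)%:Z.

Lemma digit_le1 (s : seq int) (i : nat) : (`|digit s i| <= 1)%N.
Proof. by rewrite /digit; do 2 case: (_ \in s). Qed.

Lemma digit_of_mem (s : seq int) (j : int) :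
  reduced s -> j \in s -> digit s `|j|.-1 = sgz j.
Proof.
move=> rs js; have j0 := reduced_neq0 rs js; have := reduced_opp rs js.
rewrite /digit; have [jp|jn] : j = `|j|.-1.+1%:Z \/ - j = `|j|.-1.+1%:Z by lia.
  by rewrite -jp js => /negPf ->; lia.
by rewrite -jn opprK js => /negPf ->; lia.
Qed.

Lemma mem_of_digit (s : seq int) (j : int) :
  j != 0 -> digit s `|j|.-1 = sgz j -> j \in s.
Proof.
rewrite /digit => j0.
have [jp|jn] : j = `|j|.-1.+1%:Z \/ - j = `|j|.-1.+1%:Z by lia.
  by rewrite -jp; case: (j \in s) => //; case: (_ \in s); lia.
by rewrite -jn opprK; case: (j \in s) => //; case: (_ \in s); lia.
Qed.

Lemma kseq_digit (b : nat) (j : int) :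
  j != 0 -> kseq b j = sgz j * b%:Z ^+ `|j|.-1.
Proof. by case: j => [[|n]|n] //= _; rewrite ?mul1r //= mulN1r. Qed.

Lemma ksum_digit (b N : nat) (s : seq int) :
  uniq s -> {in s, forall j : int, `|j| <= N}%N ->
  ksum b s = \sum_(i < N) digit s i * b%:Z ^+ i.
Proof.
rewrite /ksum; elim: s => [|j s IHs] /=.
  by rewrite big_nil big1 // => i _; rewrite /digit subrr mul0r.
case/andP=> jns us sN; rewrite big_cons IHs //; last first.
  by move=> k ks; apply: sN; rewrite inE ks orbT.
have digitE i : digit (j :: s) i = digit s i + digit [:: j] i.
  rewrite /digit !inE /=.
  case: (i.+1%:Z =P j) => [e1|_]; case: (- i.+1%:Z =P j) => [e2|_] /=.
  - by move: e1 e2; lia.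
  - by rewrite e1 (negPf jns); case: (_ \in s).
  - by rewrite e2 (negPf jns); case: (_ \in s).
  by rewrite subrr addr0.
under [RHS]eq_bigr do rewrite digitE mulrDl.
rewrite big_split /= addrC; congr (_ + _).
have [->|j0] := eqVneq j 0.
  by rewrite /= big1 // => i _; rewrite /digit !inE; case: eqP; case: eqP; lia.
have jN : (`|j| <= N)%N by apply: sN; rewrite inE eqxx.
have jlt : (`|j|.-1 < N)%N by lia.
rewrite (bigD1 (Ordinal jlt)) //= big1 ?addr0 => [|i].
  rewrite kseq_digit //; congr (_ * _); rewrite /digit !inE.
  case: eqP; case: eqP; lia.
rewrite -val_eqE /= /digit !inE => ij.
by case: eqP => [|_]; [lia|case: eqP => [|_]; [lia|rewrite mul0r]].
Qed.

Lemma bounded_indices (s : seq int) :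
  exists N : nat, {in s, forall j : int, `|j| <= N}%N.
Proof.
exists (\max_(j <- s) `|j|%N) => j js; exact: leq_bigmax_seq.
Qed.

Lemma reduced_ksum_inj (b : nat) (s s' : seq int) :
  (3 <= b)%N -> reduced s -> reduced s' -> ksum b s = ksum b s' -> s = s'.
Proof.
move=> b3 rs rs' ss'; have [N ssN] := bounded_indices (s ++ s').
have sN : {in s, forall j : int, `|j| <= N}%N.
  by move=> j js; apply: ssN; rewrite mem_cat js.
have s'N : {in s', forall j : int, `|j| <= N}%N.
  by move=> j js; apply: ssN; rewrite mem_cat js orbT.
have digitE i : (i < N)%N -> digit s i = digit s' i.
  move=> iN; apply/eqP; rewrite -subr_eq0; apply/eqP; move: i iN.
  apply: (@digits_eq0 b N (fun i => digit s i - digit s' i)) => [i _|].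
    have := digit_le1 s i; have := digit_le1 s' i; lia.
  under eq_bigr do rewrite mulrBl.
  by rewrite sumrB -!ksum_digit ?reduced_uniq // ss' subrr.
have memE s1 s2 j : reduced s1 -> {in s1, forall j : int, `|j| <= N}%N ->
    (forall i, (i < N)%N -> digit s1 i = digit s2 i) -> j \in s1 -> j \in s2.
  move=> rs1 s1N e12 js1; have j0 := reduced_neq0 rs1 js1.
  by apply: mem_of_digit => //; rewrite -e12 ?digit_of_mem //; have := s1N j js1; lia.
apply: (@irr_sorted_eq _ (fun j k : int => `|k| < `|j|)%N).
- by move=> k j l /= kj lk; exact: ltn_trans lk kj.
- by move=> j /=; rewrite ltnn.
- by case/andP: rs => /pairwise_sorted.
- by case/andP: rs' => /pairwise_sorted.
by move=> j; apply/idP/idP; apply: memE => // i iN; rewrite digitE.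
Qed.

(** Over a duplicate-free list of indices the only redundancy is the presence
    of both [j] and [- j], whose terms cancel: drop such pairs and the index 0,
    and sort the rest by decreasing absolute value. *)
Lemma reduction (s : seq int) :
  uniq s ->
  exists s', [/\ reduced s', {subset s' <= s} & forall b, ksum b s' = ksum b s].
Proof.
move=> us; pose sub := [seq j <- s | (j != 0) && (- j \notin s)].
pose ge_abs := [rel j k : int | `|k| <= `|j|]%N.
pose s' := sort ge_abs sub.
have memE j : j \in s' = [&& j != 0, - j \notin s & j \in s].
  by rewrite mem_sort mem_filter andbA.
have us' : uniq s' by rewrite sort_uniq filter_uniq.
have ps' : pairwise ge_abs s'.
  rewrite -sorted_pairwise; last first.
    by move=> k j l /= kj lk; exact: leq_trans lk kj.
  by apply: sort_sorted => j k; exact: leq_total.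
exists s'; split=> [||b].
- apply/andP; split; last first.
    by apply/allP => j; rewrite memE => /andP[j0 _]; rewrite absz_gt0.
  move: us'; rewrite uniq_pairwise => us'.
  have := pairwise_relI [rel j k : int | j != k] ge_abs s'.
  rewrite us' ps' /= => ps''.
  apply: sub_in_pairwise ps''; [|exact: (allss s')].
  move=> j k; rewrite !memE /= => /and3P[_ js' js] /and3P[_ _ ks] /andP[jk le].
  rewrite ltn_neqAle le andbT; apply: contra jk => /eqP kj.
  have [->//|jk] : j = k \/ - j = k by lia.
  by rewrite jk ks in js'.
- by move=> j; rewrite memE => /and3P[].
have [N sN] := bounded_indices s.
rewrite !(@ksum_digit _ N) //; last first.
  by move=> j; rewrite memE => /and3P[_ _ /sN].
apply: eq_bigr => i _; congr (_ * _); rewrite /digit !memE opprK.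
by case: (i.+1%:Z \in s); case: (- i.+1%:Z \in s) => //=; rewrite ?andbF ?andbT //; lia.
Qed.

Lemma kseq_inj (b : nat) (j k : int) :
  (3 <= b)%N -> j != 0 -> k != 0 -> kseq b j = kseq b k -> j = k.
Proof.
move=> b3 j0 k0 jk.
have red1 (i : int) : i != 0 -> reduced [:: i].
  by move=> i0; rewrite /reduced /= absz_gt0 i0.
suff [] : [:: j] = [:: k] by [].
by apply: (@reduced_ksum_inj b); rewrite ?red1 // /ksum !big_seq1.
Qed.

(** Finite sums are defined through sets of values and expansions through lists
    of indices. As [reduction] only drops indices, an expansion can be found
    with all its indices in [J], whatever [J] is. *)
Lemma finite_sumsP (b : nat) (J : set int) (t : int) :
  (3 <= b)%N ->
  finite_sums (kseq b @` J) t <->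
  exists s, [/\ reduced s, {in s, forall j, J j} & t = ksum b s].
Proof.
move=> b3; split=> [[F [FJ ->]]|[s [rs sJ ->]]].
  have [s sJ sF] : exists2 s, {in s, forall j, J j} & [seq kseq b j | j <- s] = F.
    have : {in (F : seq int), forall x, (kseq b @` J) x} by move=> x /FJ.
    elim: (F : seq int) => [|x l IHl] lJ; first by exists [::].
    have [|s sJ <-] := IHl; first by move=> y yl; apply: lJ; rewrite inE yl orbT.
    have [j Jj <-] := lJ x (mem_head _ _).
    by exists (j :: s) => // k; rewrite inE => /predU1P[->|/sJ].
  have us : uniq s by apply: (@map_uniq _ _ (kseq b)); rewrite sF fset_uniq.
  have [s' [rs' s's ks']] := reduction us.
  exists s'; split=> // [j /s's /sJ //|].
  by rewrite -sF big_map ks'.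
have us : uniq [seq kseq b j | j <- s].
  rewrite map_inj_in_uniq ?reduced_uniq // => j k js ks.
  by apply: kseq_inj => //; exact: reduced_neq0 rs _.
exists [fset x in [seq kseq b j | j <- s]]%fset; split=> [x|].
  by rewrite /= in_fset /= => /mapP[j js ->]; exists j => //; exact: sJ.
rewrite /ksum -(big_map (kseq b) xpredT id); apply: perm_big.
apply: uniq_perm => [||x]; [by []|exact: fset_uniq|by rewrite in_fset].
Qed.

(** The worst case is 1 + b + ... + b ^ (m - 1), which is less than half of
    [b ^ m] as soon as [b >= 3]. *)
Lemma ksum_lt (b m : nat) (s : seq int) :
  (3 <= b)%N -> reduced s -> {in s, forall j : int, `|j| <= m}%N ->
  (`|ksum b s| * 2 < b ^ m)%N.
Proof.
move=> b3 rs sm; rewrite (@ksum_digit b m) ?reduced_uniq // => {sm}.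
elim: m => [|m IHm]; first by rewrite big_ord0.
rewrite big_ord_recr /= expnS.
have : (`|(digit s m * b%:Z ^+ m)%R| <= b ^ m)%N.
  by rewrite abszM abszX absz_nat -[leqRHS]mul1n leq_mul2r digit_le1 orbT.
have : (3 * b ^ m <= b * b ^ m)%N by rewrite leq_mul2r b3 orbT.
move: IHm; set x := (\sum_(i < m) _); set y := (_ * b%:Z ^+ m)%R.
by clearbody x y; lia.
Qed.

Lemma ksum_dvd (b m : nat) (s : seq int) :
  {in s, forall j : int, m < `|j|}%N -> (b%:Z ^+ m %| ksum b s)%Z.
Proof.
move=> sm; rewrite /ksum big_seq; apply: rpred_sum => j /sm mj.
rewrite kseq_digit; last by lia.
rewrite -(subnKC (_ : m <= `|j|.-1)%N); last by lia.
by rewrite exprD mulrCA dvdz_mulr.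
Qed.

Lemma ksum_filter (b : nat) (p : pred int) (s : seq int) :
  ksum b s = ksum b [seq j <- s | p j] + ksum b [seq j <- s | ~~ p j].
Proof. by rewrite /ksum !big_filter (bigID p). Qed.

(** The digits of [t + u] of index at most [m] sum to an integer congruent to
    [t] modulo [b ^ m]; both being less than half of [b ^ m] in absolute
    value, they are equal. In particular [t] is then a finite sum itself. *)
Lemma low_part (b m : nat) (s : seq int) (t u : int) :
  (3 <= b)%N -> reduced s -> ksum b s = t + u ->
  (b%:Z ^+ m %| u)%Z -> (`|t| * 2 < b ^ m)%N ->
  t = ksum b [seq j <- s | `|j| <= m]%N.
Proof.
move=> b3 rs stu um tm; set lo := [seq j <- s | _].
have lom : (`|ksum b lo| * 2 < b ^ m)%N.
  by apply: ksum_lt; rewrite ?reduced_filter // => j; rewrite mem_filter => /andP[].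
have dvd : (b%:Z ^+ m %| t - ksum b lo)%Z.
  have hi : (b%:Z ^+ m %| ksum b [seq j <- s | ~~ (`|j| <= m)%N])%Z.
    by apply: ksum_dvd => j; rewrite mem_filter -ltnNge => /andP[].
  have -> : t - ksum b lo = ksum b [seq j <- s | ~~ (`|j| <= m)%N] - u.
    have := ksum_filter b (fun j : int => `|j| <= m)%N s; rewrite stu -/lo; lia.
  by rewrite rpredB.
move: dvd; rewrite dvdzE abszX absz_nat => dvd.
apply/eqP; rewrite -subr_eq0 -absz_eq0; apply: contraTT dvd => d0.
apply/negP => /dvdn_leq; rewrite lt0n d0 => /(_ isT); move: tm lom; lia.
Qed.

Lemma length_vector_ksum (b : nat) (D : posnat -> set nat) (s : seq int) (l : posnat) :
  (3 <= b)%N -> trivIset setT D -> reduced s ->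
  length_vector b D (ksum b s) l = hits D s l.
Proof.
move=> b3 tD rs; rewrite length_vectorE //; congr hits.
apply: xget_unique; first by apply/is_expansionE.
by move=> s' /is_expansionE[ss' rs']; apply: (@reduced_ksum_inj b).
Qed.

(** Adding to [s] a part [lo] of itself produces digits 2 or -2. They differ
    from -1, 0, 1 by at most 3, less than [b], so [digits_eq0] forbids any other
    expansion of the sum. *)
Lemma no_doubling (b : nat) (s lo s' : seq int) :
  (5 <= b)%N -> reduced s -> reduced lo -> reduced s' -> {subset lo <= s} ->
  ksum b s' = ksum b s + ksum b lo -> lo = [::].
Proof.
move=> b5 rs rlo rs' los sumE; case lo_def: lo => [//|j lo'].
have jlo : j \in lo by rewrite lo_def mem_head.
have [N bndN] := bounded_indices (s ++ s').
have sN : {in s, forall j : int, `|j| <= N}%N.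
  by move=> k ks; apply: bndN; rewrite mem_cat ks.
have s'N : {in s', forall j : int, `|j| <= N}%N.
  by move=> k ks; apply: bndN; rewrite mem_cat ks orbT.
have loN : {in lo, forall j : int, `|j| <= N}%N by move=> k /los /sN.
pose e i := digit s i + digit lo i - digit s' i.
have j0 := reduced_neq0 rlo jlo.
have e0 : e `|j|.-1 = 0.
  apply: (@digits_eq0 b N) => [i _||].
  - rewrite /e; move: b5 (digit_le1 s i) (digit_le1 lo i) (digit_le1 s' i); lia.
  - under eq_bigr do rewrite /e mulrBl mulrDl.
    by rewrite sumrB big_split /= -!ksum_digit ?reduced_uniq // sumE subrr.
  - by have := loN j jlo; lia.
move: e0; rewrite /e (digit_of_mem rs (los j jlo)) (digit_of_mem rlo jlo).
by have := digit_le1 s' `|j|.-1; lia.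
Qed.

(** * Realizing vectors by sums of large indices *)

Lemma infinite_gt (A : set nat) (n : nat) :
  infinite_set A -> exists2 k, A k & (n < k)%N.
Proof.
move=> infA; apply: contrapT => noA; apply: infA.
apply: (@sub_finite_set _ _ `I_n.+1); last exact: finite_II.
by move=> k Ak; rewrite /= ltnS leqNgt; apply/negP => nk; apply: noA; exists k.
Qed.

(** Prepend, for each entry of [L], an element of the corresponding class that
    exceeds all the indices used so far. *)
Lemma realize_count (D : posnat -> set nat) (L : seq posnat) (m : nat) :
  trivIset setT D -> (forall l, infinite_set (D l)) ->
  exists s, [/\ reduced s, {in s, forall j : int, m%:Z < j} &
             forall l, hits D s l = count_mem l L].
Proof.
move=> tD infD; elim: L => [|l L [s [rs sm sL]]]; first by exists [::].
have [N sN] := bounded_indices s.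
have [n Dn Nmn] := infinite_gt (maxn N m) (infD l).
move: Nmn; rewrite gtn_max => /andP[Nn mn].
exists (n%:Z :: s); split=> [|j|l'].
- case/andP: rs => ps s0; rewrite /reduced /= ps s0 !andbT; apply/andP; split.
    by apply/allP => j /sN jN /=; exact: leq_ltn_trans jN Nn.
  exact: leq_ltn_trans mn.
- by rewrite inE => /predU1P[->|/sm //]; rewrite ltz_nat.
rewrite /hits /= -/(hits D s l') sL; congr (nat_of_bool _ + _)%N.
apply/idP/eqP => [|<-]; last by rewrite inE.
by rewrite inE /= => Dn'; apply: tD => //; exists n.
Qed.

Lemma nvector_count (v : Nvector) :
  exists L : seq posnat, forall l, count_mem l L = v l.
Proof.
exists (flatten [seq nseq (v l) l | l <- finsupp v]) => l.
rewrite count_flatten sumnE !big_map.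
have [lv|lv] := boolP (l \in finsupp v).
  rewrite (bigD1_seq l) ?fset_uniq //= count_nseq /= eqxx mul1n big1 ?addn0 // => k.
  by rewrite count_nseq /= => /negPf ->.
rewrite big_seq big1 ?fsfun_dflt // => k kv.
rewrite count_nseq /=; case: eqP => [e|//]; by rewrite e (negPf lv) in kv.
Qed.

Lemma realize_nvector (D : posnat -> set nat) (v : Nvector) (m : nat) :
  trivIset setT D -> (forall l, infinite_set (D l)) ->
  exists s, [/\ reduced s, {in s, forall j : int, m%:Z < j} &
             forall l, hits D s l = v l].
Proof.
move=> tD infD; have [L Lv] := nvector_count v.
have [s [rs sm sL]] := realize_count L m tD infD.
by exists s; split=> // l; rewrite sL.
Qed.

Lemma finite_nvec_box (N : nat) : finite_set (nvec_box N).
Proof.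
pose code (v : Nvector) : {ffun 'I_N -> 'I_N.+1} :=
  [ffun i : 'I_N => inord (v (exist (fun n => (0 < n)%N) i.+1 isT))].
have code_inj v w : nvec_box N v -> nvec_box N w -> code v = code w -> v = w.
  move=> [vN sv] [wN sw] /ffunP vw; apply/fsfunP => -[[//|n] n0].
  have [nN|Nn] := ltnP n N; last first.
    have out (u : Nvector) (su : forall l, l \in finsupp u -> (1 <= val l <= N)%N) :
        u (exist (fun n => (0 < n)%N) n.+1 n0) = 0%N.
      by apply: fsfun_dflt; apply/negP => /su /=; rewrite ltnNge Nn.
    by rewrite !out.
  have := congr1 (@nat_of_ord _) (vw (Ordinal nN)); rewrite !ffunE.
  rewrite (_ : exist _ _ _ = exist _ n.+1 n0); last exact: val_inj.
  by rewrite !inordK // ltnS ltnW.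
(* A partial inverse of [code], through which the box becomes the image of a
   finite type. *)
pose decode c : Nvector := xget nvec0 [set v | nvec_box N v /\ code v = c].
apply: (@sub_finite_set _ _ (range decode)) => [v vN|]; last exact: finite_image.
exists (code v) => //; rewrite /decode; apply: xget_unique => // w [wN wv].
exact: code_inj.
Qed.

(** The bound [K] is uniform over the box because the box is finite. *)
Lemma realize_nvec_box (D : posnat -> set nat) (N : nat) :
  trivIset setT D -> (forall l, infinite_set (D l)) ->
  exists K : nat, forall v, nvec_box N v ->
    exists s, [/\ reduced s, {in s, forall j : int, 0 < j},
                  {in s, forall j : int, `|j| <= K}%N & forall l, hits D s l = v l].
Proof.
move=> tD infD.
have /finite_seqP[B BE] := finite_nvec_box N.
have /choice[f fP] v := realize_nvector v 0 tD infD.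
have /choice[k kP] v := bounded_indices (f v).
exists (\max_(v <- B) k v) => v; rewrite BE /= => vB.
have [rv v0 hv] := fP v; exists (f v); split=> // j jv.
exact: leq_trans (kP v j jv) (leq_bigmax_seq _ vB isT).
Qed.

(** * Recurrence of a label and of its point *)

(** Common generalization of [Aset] (every index) and [Aset_plus] (nonnegative
    indices). *)
Definition Aset_over (b : nat) (D : posnat -> set nat) (J : set int)
    (M : label) : set int :=
  [set t | finite_sums (kseq b @` J) t /\ label_set M (length_vector b D t)].

Section Recurrence.

Variables (b : nat) (D : posnat -> set nat) (J : set int).
Hypothesis b5 : (5 <= b)%N.
Hypothesis tD : trivIset setT D.
Hypothesis coverD : forall n, (0 < n)%N -> exists l, D l n.
Hypothesis infD : forall l, infinite_set (D l).
Hypothesis posJ : forall j : int, 0 < j -> J j.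

Let b3 : (3 <= b)%N := leq_trans (isT : (3 <= 5)%N) b5.

Lemma Aset_over_ksum (M : label) (s : seq int) :
  reduced s ->
  Aset_over b D J M (ksum b s) <->
  {in s, forall j, J j} /\ label_set M (length_vector b D (ksum b s)).
Proof.
move=> rs; split=> [[/(finite_sumsP _ _ b3)[s' [rs' s'J ss']]] Ms|[sJ Ms]].
  by rewrite (reduced_ksum_inj b3 rs rs' ss') -ss'.
by split=> //; apply/(finite_sumsP _ _ b3); exists s.
Qed.

Lemma length_vector_cat (m : nat) (hi lo : seq int) :
  reduced hi -> reduced lo ->
  {in hi, forall j : int, m < `|j|}%N -> {in lo, forall j : int, `|j| <= m}%N ->
  length_vector b D (ksum b hi + ksum b lo) =
  length_vector b D (ksum b lo) + length_vector b D (ksum b hi).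
Proof.
move=> rhi rlo him lom; have rhl := reduced_cat rhi rlo him lom.
rewrite -[ksum b hi + _]big_cat; apply/fsfunP => l.
rewrite [RHS]nvec_addE !length_vector_ksum //.
by rewrite /hits count_cat addnC.
Qed.

(** Near 0, translating the set of [M] by a sum of large indices amounts to
    translating the label [M] by the length vector of that sum. *)
Lemma Aset_over_high (M : label) (m : nat) (hi lo : seq int) :
  reduced hi -> reduced lo ->
  {in hi, forall j : int, m < `|j|}%N -> {in lo, forall j : int, `|j| <= m}%N ->
  {in hi, forall j, J j} ->
  Aset_over b D J M (ksum b lo + ksum b hi) <->
  Aset_over b D J (label_sub M (length_vector b D (ksum b hi))) (ksum b lo).
Proof.
move=> rhi rlo him lom hiJ; have rhl := reduced_cat rhi rlo him lom.
have lvE := length_vector_cat rhi rlo him lom.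
have catE : ksum b hi + ksum b lo = ksum b (hi ++ lo) by rewrite /ksum big_cat.
rewrite addrC (Aset_over_ksum _ rlo) catE Aset_over_ksum // -catE lvE /=.
split=> -[HJ HM]; split=> // j.
  by move=> jlo; apply: HJ; rewrite mem_cat jlo orbT.
by rewrite mem_cat => /orP[/hiJ|/HJ].
Qed.

Lemma length_vector_neq0 (s : seq int) :
  reduced s -> s != [::] -> length_vector b D (ksum b s) != 0.
Proof.
case: s => [//|j s] rs _; have j0 := reduced_neq0 rs (mem_head j s).
have [l Dl] : exists l, D l `|j|%N by apply: coverD; rewrite absz_gt0.
apply/eqP => /fsfunP /(_ l); rewrite length_vector_ksum // fsfunE.
by rewrite /hits /= mem_set.
Qed.

(** A sum [ksum b hi] of large indices whose length vector is a return vector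
    of [M] is a return time of the point. *)
Lemma label_recurrent_shift (M : label) :
  (forall N : nat, exists2 r : Nvector, r != 0 & agree N (label_sub M r) M) ->
  shift_recurrent (char_fun (Aset_over b D J M)).
Proof.
move=> recM; apply/shift_recurrentP => T.
have /choice[f fP] t := nvec_box_cover (length_vector b D t).
pose N := \max_(i < T.+1) maxn (f i%:Z) (f (- i%:Z)).
have boxN (t : int) : (`|t| <= T)%N -> nvec_box N (length_vector b D t).
  move=> tT; apply: nvec_box_le (fP t); rewrite /N.
  apply: (@leq_trans (maxn (f `|t|%N%:Z) (f (- `|t|%N%:Z)))).
    have [tE|tE] : t = `|t|%N%:Z \/ t = - `|t|%N%:Z by lia.
      by rewrite -tE leq_maxl.
    by rewrite -tE leq_maxr.
  have tT' : (`|t| < T.+1)%N by rewrite ltnS.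
  exact: (leq_bigmax (Ordinal tT')).
have [r r0 ag] := recM N.
(* Any [m] with [T * 2 < b ^ m] would do. *)
pose m := (T * 2)%N.
have [hi [rhi him hir]] := realize_nvector r m tD infD.
have hiJ : {in hi, forall j, J j} by move=> j /him mj; apply: posJ; lia.
have {}him : {in hi, forall j : int, m < `|j|}%N by move=> j /him; lia.
have lhi : length_vector b D (ksum b hi) = r.
  by apply/fsfunP => l; rewrite length_vector_ksum.
(* The proposed return time is nonzero since its length vector is. *)
exists (ksum b hi).
  apply: contraNneq r0 => hi0; rewrite -lhi hi0; apply/eqP/fsfunP => l.
  rewrite -[0](_ : ksum b [::] = 0) ?length_vector_ksum // /ksum ?big_nil //.
  by rewrite fsfunE.
move=> t tT.
have tm : (`|t| * 2 < b ^ m)%N.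
  apply: leq_ltn_trans (_ : m < _)%N; first by rewrite leq_mul2r tT.
  by apply: ltn_expl; lia.
have low (u : int) : (b%:Z ^+ m %| u)%Z -> Aset_over b D J M (t + u) ->
    exists lo, [/\ reduced lo, {in lo, forall j : int, `|j| <= m}%N & t = ksum b lo].
  move=> um [/(finite_sumsP _ _ b3)[s [rs _ tus]] _].
  exists [seq j <- s | `|j| <= m]%N; split; first exact: reduced_filter.
    by move=> j; rewrite mem_filter => /andP[].
  exact: low_part (esym tus) um tm.
(* Integers of the window without expansion are outside both sets by [low];
   for the others the two memberships are compared through the label. *)
have key lo : reduced lo -> {in lo, forall j : int, `|j| <= m}%N -> t = ksum b lo ->
    Aset_over b D J M (t + ksum b hi) <-> Aset_over b D J M t.
  move=> rlo lom tlo; rewrite tlo (Aset_over_high M rhi rlo him lom hiJ) -tlo lhi.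
  have agM : label_set (label_sub M r) (length_vector b D t) <->
      label_set M (length_vector b D t).
    have tN := boxN t tT; move/seteqP: ag => [subM Msub].
    by split=> Mt; [have [] := subM _ (conj Mt tN)|have [] := Msub _ (conj Mt tN)].
  by split=> -[IPt /agM].
apply/idP/idP; rewrite !in_setE => At.
  by have [lo [rlo lom tlo]] := low _ (ksum_dvd b him) At; apply/(key lo).
have [||lo [rlo lom tlo]] := low 0; rewrite ?addr0 ?dvdz0 //.
by apply/(key lo).
Qed.

(** A return time of a large window has no digit of small index, and its length
    vector is then a return vector of [M]. *)
Lemma shift_recurrent_label (M : label) :
  shift_recurrent (char_fun (Aset_over b D J M)) ->
  forall N : nat, exists2 r : Nvector, r != 0 & agree N (label_sub M r) M.
Proof.
move=> /shift_recurrentP recx N.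
(* The label without elements is invariant under every translation. *)
have [M0|nM0] := pselect (label_set M 0); last first.
  have nM v : ~ label_set M v.
    by move=> Mv; apply: nM0; apply: label_down Mv => l; rewrite fsfunE.
  exists (length_vector b D (ksum b [:: 1])); first exact: length_vector_neq0.
  by apply/seteqP; split=> v [/nM].
have [K KP] := realize_nvec_box N tD infD.
have [n n0 nP] := recx (b ^ K)%N.
have ret (t : int) : (`|t| <= b ^ K)%N ->
    Aset_over b D J M (t + n) <-> Aset_over b D J M t.
  move=> tT.
  have tn : (t + n \in Aset_over b D J M) = (t \in Aset_over b D J M) := nP t tT.
  by split=> /mem_set At; apply/set_mem; [rewrite -tn|rewrite tn].
have A0 : Aset_over b D J M 0.
  have -> : 0 = ksum b [::] by rewrite /ksum big_nil.
  apply/Aset_over_ksum => //; split=> //.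
  by apply: label_down M0 => l; rewrite length_vector_ksum.
have := A0; rewrite -ret // add0r => -[/(finite_sumsP _ _ b3)[s [rs sJ ns]] Ms].
rewrite ns in Ms.
pose lo := [seq j <- s | `|j| <= K]%N.
have rlo : reduced lo by exact: reduced_filter.
have los : {subset lo <= s} by exact: mem_subseq (filter_subseq _ _).
have loK : {in lo, forall j : int, `|j| <= K}%N.
  by move=> j; rewrite mem_filter => /andP[].
have small (s1 : seq int) : reduced s1 -> {in s1, forall j : int, `|j| <= K}%N ->
    (`|ksum b s1| <= b ^ K)%N.
  by move=> rs1 s1K; have := ksum_lt b3 rs1 s1K; lia.
(* Otherwise returning from [lo] would double the digits of [lo]. *)
have lo0 : lo = [::].
  have Alo : Aset_over b D J M (ksum b lo).
    apply/Aset_over_ksum => //; split; first by move=> j /los /sJ.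
    apply: label_down Ms => l; rewrite !length_vector_ksum //.
    by rewrite /hits count_filter; apply: sub_count => j /andP[].
  have := Alo; rewrite -ret ?small // ns => -[/(finite_sumsP _ _ b3)[s' [rs' _ ss']] _].
  by apply: (@no_doubling b s lo s') => //; rewrite -ss' addrC.
have sK : {in s, forall j : int, K < `|j|}%N.
  move=> j js; rewrite ltnNge; apply/negP => jK.
  by have : j \in lo; [rewrite mem_filter jK|rewrite lo0].
exists (length_vector b D (ksum b s)).
  apply: length_vector_neq0 => //; apply: contraNneq n0 => s0.
  by rewrite ns s0 /ksum big_nil.
suff MrM v : nvec_box N v ->
    label_set (label_sub M (length_vector b D (ksum b s))) v <-> label_set M v.
  by apply/seteqP; split=> v [Mv vN]; split=> //; apply/MrM.
move=> /KP[sv [rsv sv0 svK svv]].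
have svJ : {in sv, forall j, J j} by move=> j /sv0 /posJ.
have <- : length_vector b D (ksum b sv) = v.
  by apply/fsfunP => l; rewrite length_vector_ksum.
have AM (M' : label) : Aset_over b D J M' (ksum b sv) <->
    label_set M' (length_vector b D (ksum b sv)).
  by rewrite Aset_over_ksum //; split=> [[]|].
rewrite -!AM -(Aset_over_high M rs rsv sK svK sJ) -ns.
exact: ret (small sv rsv svK).
Qed.

Lemma label_recurrent_iff_shift (R : realType) (M : LAB R) :
  label_recurrent M <-> shift_recurrent (char_fun (Aset_over b D J M)).
Proof.
split=> [/label_recurrentP|recx]; first exact: label_recurrent_shift.
by apply/label_recurrentP; exact: shift_recurrent_label.
Qed.

End Recurrence.

Theorem corollary3p26 (R : realType) (b : nat) (hb_odd : odd b) (hb : (5 <= b)%N)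
    (D : posnat -> set nat) (hD : ip_partition D) (M : LAB R) :
  (label_recurrent M <-> shift_recurrent (char_fun (Aset b D M))) /\
  (shift_recurrent (char_fun (Aset b D M)) <->
     shift_recurrent (char_fun (Aset_plus b D M))).
Proof.
have [[coverD tD _] infD _] := hD.
have cover n : (0 < n)%N -> exists l, D l n.
  by move=> n0; have : [set n | (0 < n)%N] n by []; rewrite -coverD => -[l _]; exists l.
have plusE : Aset_plus b D M = Aset_over b D [set j : int | 0 <= j] M.
  rewrite /Aset_plus /Aset /Aset_over /IPplus; apply/seteqP; split=> t.
    by move=> [[_ Mt] IPt].
  move=> [IPt Mt]; split=> //; split=> //.
  have [F [FJ ->]] := IPt; exists F; split=> //.
  by move=> x /FJ[j _ <-]; exists j.
rewrite plusE -[Aset b D M]/(Aset_over b D setT M).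
by rewrite -!label_recurrent_iff_shift // => j /ltW.
Qed.
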